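(* Let $\Gamma>1$ and $S_{min}>0$ be constants. For the 1D Euler and Navier–Stokes systems, the invariant region $$\widetilde G=\Big\{\mathbf u=(\rho,m,E)^\top\in\mathbb R^3:\ \rho>0,\ \ \frac{\Gamma-1}{\rho^{\Gamma}}\Big(E-\frac{m^2}{2\rho}\Big)-S_{min}\ge 0\Big\}$$ has the GQL representation $$\widetilde G_*=\Big\{\mathbf u=(\rho,m,E)^\top\in\mathbb R^3:\ \rho>0,\ \ \widetilde\varphi(\mathbf u;\rho_*,v_* )\ge 0\quad\forall\,\rho_*\in\mathbb R^+,\ \forall\, v_*\in\mathbb R\Big\},$$ where $$\widetilde\varphi(\mathbf u;\rho_*,v_* ):=\mathbf u\cdot\mathbf n_*+S_{min}\rho_*^{\Gamma},\qquad \mathbf n_*:=\Big(\frac{v_*^2}{2}-\frac{S_{min}\Gamma\rho_*^{\Gamma-1}}{\Gamma-1},\ -v_*,\ 1\Big)^\top ;$$ that is, $\widetilde G=\widetilde G_*$.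
   Context: A GQL (equivalent linear) representation of a set is an equal set described by constraints that are all affine in $\mathbf u$, possibly quantified over auxiliary parameters independent of $\mathbf u$. Here $\rho,m,E$ are density, momentum and total energy, $\Gamma$ is the ratio of specific heats of the ideal equation of state $p=(\Gamma-1)\rho e$ with $\rho e=E-\frac{m^2}{2\rho}$, $S=p\rho^{-\Gamma}$ is the specific entropy, and $S_{min}=\min_x S(\mathbf u_0(x))$ is the minimum of the entropy of the initial data $\mathbf u_0$ (positive since the initial density and pressure are positive). $\mathbb R^+=(0,\infty)$. *)

(* Defs.v *)
From HB Require Import structures.
From mathcomp Require Import all_boot all_order all_algebra.
From mathcomp Require Import all_classical all_reals all_analysis.

Set Implicit Arguments.
Unset Strict Implicit.
Unset Printing Implicit Defensive.

Import Order.TTheory GRing.Theory Num.Theory.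

Local Open Scope classical_set_scope.
Local Open Scope ring_scope.

Section GQL.
Context {R : realType}.

Definition dotv {n : nat} (u v : 'cV[R]_n) : R := \sum_i u i 0 * v i 0.

(* The index type [I] ranges over all constraints at once, so it carries both
   the list of constraints and their auxiliary parameters; [strict i] tells
   whether the i-th affine constraint reads [> 0] or [>= 0]. *)
Definition affine_constraints_set {n : nat} (I : Type)
    (strict : I -> bool) (a : I -> 'cV[R]_n) (b : I -> R) : set 'cV[R]_n :=
  [set u | forall i, if strict i then 0 < dotv u (a i) + b i
                     else 0 <= dotv u (a i) + b i].

Definition GQL_representation {n : nat} (G Gstar : set 'cV[R]_n) : Prop :=
  G = Gstar /\
  exists (I : Type) (strict : I -> bool) (a : I -> 'cV[R]_n) (b : I -> R),
    Gstar = affine_constraints_set strict a b.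

End GQL.

Section Euler1D.
Context {R : realType}.

Definition density (u : 'cV[R]_3) : R := u 0 0.
Definition momentum (u : 'cV[R]_3) : R := u 1 0.
Definition energy (u : 'cV[R]_3) : R := u 2 0.

Definition col3 (x y z : R) : 'cV[R]_3 := \col_(i < 3) [:: x; y; z]`_i.

Variables Gamma Smin : R.

Definition Gtilde : set 'cV[R]_3 :=
  [set u | 0 < density u /\
    0 <= (Gamma - 1) / density u `^ Gamma *
           (energy u - momentum u ^+ 2 / (2 * density u)) - Smin].

Definition nstar (rhos vs : R) : 'cV[R]_3 :=
  col3 (vs ^+ 2 / 2 - Smin * Gamma * rhos `^ (Gamma - 1) / (Gamma - 1))
       (- vs)
       1.

Definition phitilde (u : 'cV[R]_3) (rhos vs : R) : R :=
  dotv u (nstar rhos vs) + Smin * rhos `^ Gamma.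

Definition Gtilde_star : set 'cV[R]_3 :=
  [set u | 0 < density u /\
    forall rhos : R, 0 < rhos -> forall vs : R, 0 <= phitilde u rhos vs].

End Euler1D.

(* Main.v *)
Require Import Defs.
From HB Require Import structures.
From mathcomp Require Import all_boot all_order all_algebra.
From mathcomp Require Import all_classical all_reals all_analysis.
From mathcomp Require Import ring.

(** For a fixed density [r > 0], the form [phitilde] is a sum of three terms
    (lemma [phitilde_decomposition]): the margin
    [E - m^2/(2r) - Smin r^Gamma/(Gamma-1)], whose sign decides the entropy
    constraint (lemma [entropy_constraintE]); a square, which vanishes at the
    velocity [vs = m/r]; and [Smin/(Gamma-1)] times the distance at [r] between
    the convex function [x |-> x^Gamma] and its tangent line at [rhos], which
    vanishes at [rhos = r].  The last two terms are nonnegative (the third by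
    Young's inequality, lemma [powR_ge_tangent]), and both vanish for the same
    admissible choice of the auxiliary parameters.  Hence the minimum of
    [phitilde] over these parameters is attained and equals the margin, which
    gives the equality of the two sets.  The starred set is described by affine
    constraints by construction: one strict constraint for the density and a
    family of nonstrict ones indexed by [rhos > 0] and [vs]. *)

Set Implicit Arguments.
Unset Strict Implicit.
Unset Printing Implicit Defensive.

Import Order.TTheory GRing.Theory Num.Theory.

Local Open Scope classical_set_scope.
Local Open Scope ring_scope.

Lemma mul_powRB1 (R : realType) (x p : R) : 0 < x -> x * x `^ (p - 1) = x `^ p.
Proof.
move=> x0; have xN0 : x != 0 by rewrite gt_eqF.
by rewrite powRB ?xN0 ?implybT// powRr1 ?ltW// mulrC divfK.
Qed.

(** The convex function [x |-> x^p] lies above its tangent line at [y]; this is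
    Young's inequality for [x] and [y^(p-1)], with exponents [p] and
    [p/(p-1)]. *)
Lemma powR_ge_tangent (R : realType) (x y p : R) :
  0 <= x -> 1 < p -> p * x * y `^ (p - 1) <= x `^ p + (p - 1) * y `^ p.
Proof.
move=> x0 p1; have p0 : 0 < p by exact: lt_trans ltr01 p1.
have q0 : 0 < p - 1 by rewrite subr_gt0.
have pN0 : p != 0 by rewrite gt_eqF.
have qN0 : p - 1 != 0 by rewrite gt_eqF.
have conj : p^-1 + (p / (p - 1))^-1 = 1 by field; rewrite pN0 qN0.
have := conjugate_powR x0 (powR_ge0 y (p - 1)) p0 (divr_gt0 p0 q0) conj.
rewrite -powRrM [(p - 1) * _]mulrC divfK// -(ler_pM2l p0) => young.
rewrite -mulrA (le_trans young)// le_eqVlt; apply/orP; left; apply/eqP.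
by field; rewrite pN0 qN0.
Qed.

Section EulerEntropy.
Context {R : realType}.
Variables Gamma Smin : R.
Hypothesis hGamma : 1 < Gamma.

Let Gamma1_gt0 : 0 < Gamma - 1. Proof. by rewrite subr_gt0. Qed.

Lemma dotv_col3 (u : 'cV[R]_3) (x y z : R) :
  dotv u (col3 x y z) = density u * x + momentum u * y + energy u * z.
Proof.
rewrite /dotv !big_ord_recl big_ord0 addr0 !mxE/= addrA /density /momentum.
rewrite /energy; congr (_ + u _ _ * _ + u _ _ * _); exact: val_inj.
Qed.

Definition entropy_margin (u : 'cV[R]_3) : R :=
  energy u - momentum u ^+ 2 / (2 * density u)
  - Smin / (Gamma - 1) * density u `^ Gamma.

Lemma entropy_constraintE (u : 'cV[R]_3) : 0 < density u ->
  (0 <= (Gamma - 1) / density u `^ Gamma *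
          (energy u - momentum u ^+ 2 / (2 * density u)) - Smin)
  = (0 <= entropy_margin u).
Proof.
move=> r0; have rG := powR_gt0 Gamma r0.
rewrite -(pmulr_rge0 (entropy_margin u) (divr_gt0 Gamma1_gt0 rG)).
rewrite /entropy_margin; congr (0 <= _).
by field; rewrite !gt_eqF.
Qed.

Lemma phitilde_decomposition (u : 'cV[R]_3) (rhos vs : R) : density u != 0 ->
  phitilde Gamma Smin u rhos vs =
  entropy_margin u
  + density u / 2 * (vs - momentum u / density u) ^+ 2
  + Smin / (Gamma - 1) * (density u `^ Gamma + (Gamma - 1) * rhos `^ Gamma
                          - Gamma * density u * rhos `^ (Gamma - 1)).
Proof.
move=> rN0; rewrite /phitilde /nstar dotv_col3 /entropy_margin.
have GN0 : Gamma - 1 != 0 by rewrite gt_eqF.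
by field; rewrite rN0 GN0.
Qed.

Lemma phitilde_ge_margin (u : 'cV[R]_3) (rhos vs : R) : 0 <= Smin ->
  0 < density u -> entropy_margin u <= phitilde Gamma Smin u rhos vs.
Proof.
move=> S0 r0; rewrite phitilde_decomposition ?gt_eqF// -addrA lerDl addr_ge0//.
  by rewrite mulr_ge0 ?sqr_ge0// divr_ge0// ltW.
rewrite mulr_ge0 ?divr_ge0// ?(ltW Gamma1_gt0)// subr_ge0.
exact: powR_ge_tangent (ltW r0) hGamma.
Qed.

Lemma phitilde_at_state (u : 'cV[R]_3) : 0 < density u ->
  phitilde Gamma Smin u (density u) (momentum u / density u) = entropy_margin u.
Proof.
move=> r0; rewrite phitilde_decomposition ?gt_eqF// -!mulrA mul_powRB1//.
by ring.
Qed.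

Lemma Gtilde_eq_star : 0 <= Smin -> Gtilde Gamma Smin = Gtilde_star Gamma Smin.
Proof.
move=> S0; apply/seteqP; split=> u [r0 hu]; split=> //.
  move=> rhos _ vs; rewrite entropy_constraintE// in hu.
  exact: le_trans hu (phitilde_ge_margin rhos vs S0 r0).
by rewrite entropy_constraintE// -phitilde_at_state//; exact: hu.
Qed.

Lemma Gtilde_star_affine :
  exists (I : Type) (strict : I -> bool) (a : I -> 'cV[R]_3) (b : I -> R),
    Gtilde_star Gamma Smin = affine_constraints_set strict a b.
Proof.
(* [None] indexes the constraint on the density. *)
exists (option ({r : R | 0 < r} * R)), (fun i => ~~ isSome i),
  (fun i => if i is Some (r, v) then nstar Gamma Smin (val r) v
            else col3 1 0 0),
  (fun i => if i is Some (r, _) then Smin * val r `^ Gamma else 0).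
have densityE (u : 'cV[R]_3) : dotv u (col3 1 0 0) + 0 = density u.
  by rewrite dotv_col3 !mulr0 mulr1 !addr0.
apply/seteqP; split=> u /=.
  move=> [r0 hu] [[[r rp] v]|] /=; first exact: hu.
  by rewrite densityE.
move=> hu; split; first by have := hu None; rewrite /= densityE.
by move=> r rp v; exact: (hu (Some (exist _ r rp, v))).
Qed.

End EulerEntropy.

Theorem theorem4p7 (R : realType) (Gamma Smin : R)
    (hGamma : 1 < Gamma) (hSmin : 0 < Smin) :
  GQL_representation (Gtilde Gamma Smin) (Gtilde_star Gamma Smin).
Proof.
split; first exact: Gtilde_eq_star hGamma (ltW hSmin).
exact: Gtilde_star_affine.
Qed.
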